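(* Let $(\mathbb{X},d_{\mathbb{X}})$ be a metric space, $\mathbb{K}=\{1,\dots,K\}$, $\mathbb{B}=\{0,1\}$, $c>0$, $r$ a positive integer, and $v^{(1)},\dots,v^{(N)}\in\mathbb{T}$ trajectories. For $(\gamma,x)\in\mathbb{B}^{|\mathbb{K}|}\times\mathbb{X}^{|\mathbb{K}|}$ let $\mathcal{D}_\gamma=\{k\in\mathbb{K}:\gamma_k=1\}$ and $$U^{(r)}(\gamma,x)=\sum_{k\in\mathbb{K}}\gamma_k\,\psi_k^{(r)}(\gamma,x_k)+(1-\gamma_k)\,\bar\psi_k^{(r)}(\gamma),$$ $$\psi_k^{(r)}(\gamma,x_k)=\sum_{n=1}^N\frac{\mathbf{1}_{\mathcal{D}_{v^{(n)}}}(k)\,[d_{\mathbb{X}}^{(c)}(x_k,v^{(n)}(k))]^r+\mathbf{1}_{\mathbb{K}\setminus\mathcal{D}_{v^{(n)}}}(k)\,c^r}{|\mathcal{D}_\gamma\cup\mathcal{D}_{v^{(n)}}|},\qquad \bar\psi_k^{(r)}(\gamma)=\sum_{n=1}^N\frac{\mathbf{1}_{\mathcal{D}_{v^{(n)}}}(k)\,c^r}{|\mathcal{D}_\gamma\cup\mathcal{D}_{v^{(n)}}|}.$$ If $(\hat\gamma,\hat x)$ minimizes $U^{(r)}$ over $\mathbb{B}^{|\mathbb{K}|}\times\mathbb{X}^{|\mathbb{K}|}$, then the trajectory $\hat v$ with domain $\{k\in\mathbb{K}:\hat\gamma_k=1\}$ defined by $\hat v(k)=\hat x_k$ whenever $\hat\gamma_k=1$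 is an $r$-th order Fréchet mean of $v^{(1)},\dots,v^{(N)}$ with respect to the OSPA trajectory metric $d_{\mathbb{T}}^{(c,r)}$.
   Context: A trajectory $u$ is a partial function from $\mathbb{K}$ to $\mathbb{X}$ with domain $\mathcal{D}_u\subseteq\mathbb{K}$; $\mathbb{T}$ is the set of all trajectories. Let $d_{\mathbb{X}}^{(c)}(y,z)=\min\{d_{\mathbb{X}}(y,z),c\}$ and $$d_{\mathbb{T}}^{(c,r)}(u,v)=\left[\frac{\sum_{k\in\mathcal{D}_u\cap\mathcal{D}_v}[d_{\mathbb{X}}^{(c)}(u(k),v(k))]^r+c^r\left(|\mathcal{D}_u\setminus\mathcal{D}_v|+|\mathcal{D}_v\setminus\mathcal{D}_u|\right)}{|\mathcal{D}_u\cup\mathcal{D}_v|}\right]^{1/r},$$ with value $0$ if both domains are empty. An $r$-th order Fréchet mean of $v^{(1)},\dots,v^{(N)}$ is any minimizer over $u\in\mathbb{T}$ of $\sum_{n=1}^N[d_{\mathbb{T}}^{(c,r)}(u,v^{(n)})]^r$. Conventions: $\mathbf{1}_X(x)=1$ if $x\in X$ and $0$ otherwise; a term whose indicator is $0$ is $0$ even if $v^{(n)}(k)$ is undefined; a term $\gamma_k\psi_k^{(r)}$ with $\gamma_k=0$ is $0$; and $0/0=0$. *)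

(* Defs.v *)
From mathcomp Require Import all_boot all_order all_algebra.
From mathcomp Require Import reals topology exp.

Set Implicit Arguments.
Unset Strict Implicit.
Unset Printing Implicit Defensive.

Import Order.TTheory GRing.Theory Num.Theory.
Local Open Scope ring_scope.

(* Conventions: {1, ..., K} is encoded as 'I_K (k stands for k + 1), and a
   partial function is a function to [option], undefined where it is [None].
   Division by zero is total in MathComp with a / 0 = 0, so 0 / 0 = 0 holds
   everywhere below. *)

Definition trajectory (K : nat) (X : Type) : Type := 'I_K -> option X.

Definition dom (K : nat) (X : Type) (u : trajectory K X) : {set 'I_K} :=
  [set k : 'I_K | isSome (u k)].

Definition is_minimizer (R : realType) (T : Type) (F : T -> R) (t : T) : Prop :=
  forall s : T, F t <= F s.

Section OSPA.
Variables (R : realType) (X : metricType R) (K : nat).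
Variables (c : R) (r : nat).

Definition cut_dist (y z : X) : R := Num.min (mdist y z) c.

(* The default value 0 is never reached in [ospa_dist], where k ranges over
   the intersection of the two domains. *)
Definition opt_cut_dist (y z : option X) : R :=
  if y is Some y' then (if z is Some z' then cut_dist y' z' else 0) else 0.

Definition ospa_dist (u v : trajectory K X) : R :=
  if #|dom u :|: dom v| == 0%N then 0
  else ((\sum_(k in dom u :&: dom v) (opt_cut_dist (u k) (v k)) ^+ r
         + c ^+ r * (#|dom u :\: dom v| + #|dom v :\: dom u|)%:R)
        / #|dom u :|: dom v|%:R) `^ (r%:R^-1).

Definition is_frechet_mean (N : nat) (v : 'I_N -> trajectory K X)
    (u : trajectory K X) : Prop :=
  is_minimizer (fun w : trajectory K X => \sum_(n < N) (ospa_dist w (v n)) ^+ r) u.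

Section Objective.
Variables (N : nat) (v : 'I_N -> trajectory K X).

Definition sel_dom (gamma : 'I_K -> bool) : {set 'I_K} :=
  [set k : 'I_K | gamma k].

(* The match yields the term carrying the indicator of the domain of v n,
   which is 0 when v n k is undefined. *)
Definition psi (k : 'I_K) (gamma : 'I_K -> bool) (y : X) : R :=
  \sum_(n < N)
    ((if v n k is Some z then (cut_dist y z) ^+ r else 0)
     + (k \notin dom (v n))%:R * c ^+ r)
    / #|sel_dom gamma :|: dom (v n)|%:R.

Definition psi_bar (k : 'I_K) (gamma : 'I_K -> bool) : R :=
  \sum_(n < N)
    ((k \in dom (v n))%:R * c ^+ r) / #|sel_dom gamma :|: dom (v n)|%:R.

Definition U (gx : ('I_K -> bool) * ('I_K -> X)) : R :=
  let: (gamma, x) := gx in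
  \sum_(k < K) ((gamma k)%:R * psi k gamma (x k)
                + (1 - (gamma k)%:R) * psi_bar k gamma).

End Objective.

End OSPA.

Definition traj_of (K : nat) (X : Type) (gamma : 'I_K -> bool) (x : 'I_K -> X) :
    trajectory K X :=
  fun k => if gamma k then Some (x k) else None.

(* Main.v *)
Require Import Defs.
From mathcomp Require Import all_boot all_order all_algebra.
From mathcomp Require Import boolp reals topology exp.

(* The r-th power of the OSPA distance splits over the time steps k: given the
   normalizing cardinal, each k contributes independently. Swapping the sums
   over n and k shows that U at (gamma, x) is exactly the Frechet objective at
   [traj_of gamma x], and every trajectory arises from some pair (gamma, x). *)

Set Implicit Arguments.
Unset Strict Implicit.
Unset Printing Implicit Defensive.

Import Order.TTheory GRing.Theory Num.Theory.
Local Open Scope ring_scope.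

Section OspaCost.
Variables (R : realType) (X : metricType R) (K : nat) (c : R) (r : nat).
Implicit Types u v w : trajectory K X.

(** Total on options, unlike [opt_cut_dist]: a mismatch of domains is charged here, so sums can run
    over all [k]. *)
Definition point_cost (y z : option X) : R :=
  match y, z with
  | Some y', Some z' => cut_dist c y' z' ^+ r
  | None, None => 0
  | _, _ => c ^+ r
  end.

Lemma point_cost_ge0 (y z : option X) : 0 <= c -> 0 <= point_cost y z.
Proof.
move=> c0; case: y z => [y|] [z|] //=; rewrite exprn_ge0 //.
by rewrite le_min mdist_ge0.
Qed.

Lemma sum_point_cost u v :
  \sum_(k in dom u :&: dom v) opt_cut_dist c (u k) (v k) ^+ r
    + c ^+ r * (#|dom u :\: dom v| + #|dom v :\: dom u|)%:R
  = \sum_k point_cost (u k) (v k).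
Proof.
(* Cardinals become sums of ones; the three index sets are disjoint, so each [k] meets at most one
   of them. *)
rewrite natrD mulrDr -!sum1_card !natr_sum !mulr_sumr.
rewrite !(big_mkcond (fun k => k \in _)) -!big_split /=.
apply: eq_bigr => k _; rewrite !inE.
by case: (u k) (v k) => [y|] [z|] /=; rewrite ?mulr1 ?addr0 ?add0r.
Qed.

Lemma ospa_dist_exp u v : 0 <= c -> (0 < r)%N ->
  ospa_dist c r u v ^+ r
  = (\sum_k point_cost (u k) (v k)) / #|dom u :|: dom v|%:R.
Proof.
move=> c0 r0; rewrite /ospa_dist sum_point_cost.
(* Both domains empty: the left side is 0 since [r] is positive, the right side by division by
   zero. *)
case: eqP => [->|_]; first by rewrite expr0n eqn0Ngt r0 invr0 mulr0.
rewrite -powR_mulrn ?powR_ge0// -powRrM mulVf ?pnatr_eq0 -?lt0n// powRr1//.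
by rewrite divr_ge0 ?sumr_ge0// => k _; exact: point_cost_ge0.
Qed.

Lemma dom_traj_of (gamma : 'I_K -> bool) (x : 'I_K -> X) :
  dom (traj_of gamma x) = sel_dom gamma.
Proof. by apply/setP => k; rewrite !inE /traj_of; case: (gamma k). Qed.

Lemma U_frechet (N : nat) (v : 'I_N -> trajectory K X)
    (gamma : 'I_K -> bool) (x : 'I_K -> X) : 0 <= c -> (0 < r)%N ->
  U c r v (gamma, x) = \sum_(n < N) ospa_dist c r (traj_of gamma x) (v n) ^+ r.
Proof.
move=> c0 r0; under [RHS]eq_bigr do
  rewrite ospa_dist_exp // dom_traj_of mulr_suml.
rewrite exchange_big; apply: eq_bigr => k _ /=.
rewrite /psi /psi_bar /traj_of.
(* Exactly one of [psi] and [psi_bar] survives, and its summands are the values of [point_cost] over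
   the same denominator. *)
case: (gamma k); rewrite ?subrr ?subr0 mul1r mul0r ?addr0 ?add0r;
  apply: eq_bigr => n _; rewrite inE; case: (v n k) => [z|] /=;
  by rewrite ?mul0r ?mul1r ?addr0 ?add0r.
Qed.

(** [traj_of] forgets the points off the domain, so any [x] can fill them in. *)
Lemma trajE w (x : 'I_K -> X) :
  w = traj_of (fun k => isSome (w k)) (fun k => odflt (x k) (w k)).
Proof. by apply/funext => k; rewrite /traj_of; case: (w k). Qed.

End OspaCost.

Theorem proposition2 (R : realType) (X : metricType R) (K N : nat) (c : R)
    (r : nat) (v : 'I_N -> trajectory K X)
    (gamma_hat : 'I_K -> bool) (x_hat : 'I_K -> X) :
  0 < c -> (0 < r)%N ->
  is_minimizer (U c r v) (gamma_hat, x_hat) ->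
  is_frechet_mean c r v (traj_of gamma_hat x_hat).
Proof.
move=> /ltW c0 r0 minU w.
(* The competitor [w] becomes a pair, with [x_hat] as filler. *)
by rewrite (trajE w x_hat) -!U_frechet.
Qed.
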